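(* Consider the system $x_{t+1}=f(x_t,w_t)$ with state space $X$, where the initial distribution $\pi_0$ of $x_0$ is a stationary measure of the Markov chain $(x_t)_{t\in\mathbb{Z}_+}$, and let $\mu$ be the associated shift-invariant law on $X^{\mathbb{Z}_+}$. Consider state estimation over a noiseless channel with the following objective (E1): for a given $\varepsilon>0$ there exists a deterministic $T(\varepsilon)\ge 0$ such that $$\sup_{t\ge T(\varepsilon)} d(x_t,\hat x_t)\le\varepsilon\quad\text{almost surely.}$$ Let $C_0$ be the smallest channel capacity above which (E1) can be achieved for every $\varepsilon>0$. If $\operatorname{supp}\mu$ is not compact, then $C_0=\infty$. Otherwise, $$C_0\ \ge\ h_{\mathrm{top}}\bigl(\theta|_{\operatorname{supp}\mu}\bigr),$$ where $\theta$ is the left shift on $X^{\mathbb{Z}_+}$.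
   Context: All logarithms are to base 2; $\mathbb{Z}_+=\{0,1,2,\dots\}$. System: $(X,d)$ is a complete metric space, $W$ is a measurable space, $f:X\times W\to X$ is Borel measurable and $f_w:=f(\cdot,w):X\to X$ is a homeomorphism for every $w\in W$. $(w_t)_{t\in\mathbb{Z}_+}$ is an i.i.d. sequence in $W$ with common law $\nu$, independent of $x_0\sim\pi_0$. With $f^x(w):=f(x,w)$, the Markov chain $(x_t)$ has transition kernel $P(B|x)=\nu((f^x)^{-1}(B))$. Shift system: $X^{\mathbb{Z}_+}$ carries the product topology, metrized by $D(\bar x,\bar y)=\sum_{t\ge0}2^{-t}\frac{d(x_t,y_t)}{1+d(x_t,y_t)}$; $\theta:X^{\mathbb{Z}_+}\to X^{\mathbb{Z}_+}$, $(\theta\bar x)_t=x_{t+1}$. The measure $\mu$ is the $\theta$-invariant Borel probability measure given on cylinder sets by $$\mu(B_0\times\cdots\times B_n\times X\times X\times\cdots)=\int_{B_0\times\cdots\times B_n}\pi_0(\mathrm{d}x_0)P(\mathrm{d}x_1|x_0)\cdots P(\mathrm{d}x_n|x_{n-1}).$$ $h_{\mathrm{top}}$ is the usual topological entropy (Bowen's definition via separated sets, log base 2) of a continuous map on a compact metric space. Coding and estimation: a noiseless channel with finite alphabet $\mathcal{M}=\{1,\dots,M\}$ delivers each input symbol $q_t\in\mathcal{M}$ unaltered ($q'_t=q_t$) and has capacity $\log|\mathcal{M}|$. A coding policy is a sequence of (measurable) maps with $q_t=\gamma^e_t(x_{[0,t]},q'_{[0,t-1]})\in\mathcal{M}$;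 an estimation policy is a sequence of maps with $\hat x_t=\gamma^d_t(q'_{[0,t]})\in X$. Here $z_{[0,t]}=(z_0,\dots,z_t)$. $C_0$ is the infimum of the capacities $\log|\mathcal{M}|$ of noiseless channels over which, for every $\varepsilon>0$, there exist coding and estimation policies achieving the objective with that $\varepsilon$ ($C_0=\infty$ if there are none). *)

(* Defs.v *)
From HB Require Import structures.
From mathcomp Require Import all_boot all_order all_algebra finmap.
From mathcomp Require Import all_classical all_reals all_analysis.
Set Implicit Arguments.
Unset Strict Implicit.
Unset Printing Implicit Defensive.
Import Order.TTheory GRing.Theory Num.Theory.
Import numFieldNormedType.Exports.
Local Open Scope classical_set_scope.
Local Open Scope ring_scope.
Local Open Scope ereal_scope.

#[short(type="completeMetricType")]
HB.structure Definition CompleteMetric (R : numDomainType) :=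
  { T of Complete T & Metric R T }.

(* The type T with its Borel sigma-algebra. *)
Notation borel T := (g_sigma_algebraType (@open T)).

(* X^{Z_+} with the product topology. *)
Notation path_space X := (prod_topology (fun _ : nat => X)).

Definition log2 (R : realType) (x : R) : R := (ln x / ln 2)%R.

(* log2 on [0, +oo], with log2 0 = -oo and log2 +oo = +oo. *)
Definition log2e (R : realType) (x : \bar R) : \bar R :=
  lne x * ((ln 2)^-1)%:E.

Definition homeomorphism (T U : topologicalType) (g : T -> U) : Prop :=
  continuous g /\
  exists h : U -> T, [/\ continuous h, cancel g h & cancel h g].

Section Independence.
Context (R : realType) (dO : measure_display) (Omega : measurableType dO).
Variable P : probability Omega R.

Definition has_law d (T : measurableType d) (Z : Omega -> T)
    (m : probability T R) : Prop :=
  forall B : set T, measurable B -> P (Z @^-1` B) = m B.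

Definition mutually_independent d (T : measurableType d)
    (w : nat -> Omega -> T) : Prop :=
  forall (J : {fset nat}) (B : nat -> set T),
    (forall j, measurable (B j)) ->
    P (\bigcap_(j in [set` J]) (w j @^-1` B j)) =
    \prod_(j <- J) P (w j @^-1` B j).

Definition sequence_sigma_algebra d (T : measurableType d)
    (w : nat -> Omega -> T) : set (set Omega) :=
  <<s \bigcup_t preimage_set_system setT (w t) measurable >>.

Definition independent_of_sequence d d' (T : measurableType d)
    (U : measurableType d') (z : Omega -> T) (w : nat -> Omega -> U) : Prop :=
  forall (A : set T) (E : set Omega),
    measurable A -> sequence_sigma_algebra w E ->
    P (z @^-1` A `&` E) = P (z @^-1` A) * P E.

End Independence.

Section StochasticSystem.
Context (R : realType) (X : completeMetricType R).
Context (dW : measure_display) (W : measurableType dW).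
Variable f : X * W -> X.

Fixpoint trajectory (Omega : Type) (x0 : Omega -> X) (w : nat -> Omega -> W)
    (t : nat) (om : Omega) : X :=
  if t is s.+1 then f (trajectory x0 w s om, w s om) else x0 om.

(* P(B|x) = nu((f^x)^{-1}(B)), with f^x = f(x, .). *)
Definition transition_kernel (nu : probability W R) (x : X) :
    set (borel X) -> \bar R :=
  pushforward nu (fun w : W => f (x, w) : borel X).

Definition stationary (nu : probability W R)
    (pi0 : probability (borel X) R) : Prop :=
  forall B : set (borel X), measurable B ->
    pi0 B = \int[pi0]_x transition_kernel nu x B.

(* path_weight nu [:: B_1; ...; B_n] x is the iterated integral
   \int_{B_1} P(dx_1|x) \int_{B_2} P(dx_2|x_1) ... \int_{B_n} P(dx_n|x_{n-1}). *)
Fixpoint path_weight (nu : probability W R) (Bs : seq (set (borel X)))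
    (x : borel X) : \bar R :=
  if Bs is B :: Bs' then
    \int[transition_kernel nu x]_(y in B) path_weight nu Bs' y
  else 1.

End StochasticSystem.

Definition left_shift (X : Type) (z : nat -> X) : nat -> X := fun t => z t.+1.

Section PathLaw.
Context (R : realType) (X : completeMetricType R).
Context (dW : measure_display) (W : measurableType dW).

Definition path_law (f : X * W -> X) (nu : probability W R)
    (pi0 : probability (borel X) R)
    (mu : probability (borel (path_space X)) R) : Prop :=
  (forall A : set (borel (path_space X)), measurable A ->
     mu (@left_shift X @^-1` A) = mu A) /\
  (forall (n : nat) (B : nat -> set (borel X)),
     (forall i, measurable (B i)) ->
     mu [set z | forall i, (i <= n)%N -> B i (z i)] =
     \int[pi0]_(x in B 0%N) path_weight f nu [seq B i | i <- iota 1 n] x).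

Definition supp (mu : probability (borel (path_space X)) R) :
    set (path_space X) :=
  [set z | forall U : set (path_space X), open U -> U z -> 0 < mu U].

Definition path_dist (x y : path_space X) : R :=
  (\big[+%R/0]_(0 <= t <oo)
     (2 ^- t * (mdist (x t) (y t) / (1 + mdist (x t) (y t)))))%R.

End PathLaw.

(* Bowen's entropy of the restriction to K of a self-map T of a space with
   distance rho; K is meant to be compact and T-invariant. *)
Section TopologicalEntropy.
Context (R : realType) (Y : choiceType).
Variables (rho : Y -> Y -> R) (T : Y -> Y) (K : set Y).

Definition bowen_dist (n : nat) (x y : Y) : R :=
  \big[Num.max/0%R]_(i < n) rho (iter i T x) (iter i T y).

Definition separated_seq (n : nat) (eps : R) (s : seq Y) : Prop :=
  [/\ uniq s, {in s, forall x, K x} &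
      {in s &, forall x y, x != y -> (eps < bowen_dist n x y)%R}].

Definition max_separated (n : nat) (eps : R) : \bar R :=
  ereal_sup [set (size s)%:R%:E | s in [set s | separated_seq n eps s]].

Definition entropy_at_scale (eps : R) : \bar R :=
  limn_esup (fun n : nat => (n%:R^-1)%:E * log2e (max_separated n eps)).

Definition topological_entropy : \bar R :=
  lim (entropy_at_scale eps @[eps --> (0%R : R)^'+]).

End TopologicalEntropy.

Section Estimation.
Context (R : realType) (X : completeMetricType R).

(* gamma t x_[0,t] q'_[0,t-1] is the symbol q_t; the alphabet is 'I_M. *)
Definition coding_policy (M : nat) : Type :=
  forall t : nat, t.+1.-tuple (borel X) -> t.-tuple 'I_M -> 'I_M.

(* 'I_M being finite, joint measurability amounts to this. *)
Definition measurable_coding (M : nat) (gamma : coding_policy M) : Prop :=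
  forall (t : nat) (h : t.-tuple 'I_M) (q : 'I_M),
    measurable [set x | gamma t x h = q].

(* Every map on the finite set of words is measurable. *)
Definition estimation_policy (M : nat) : Type :=
  forall t : nat, t.+1.-tuple 'I_M -> X.

(* The word q'_[0,t-1] received before time t when the state follows x; as the
   channel is noiseless, q'_t = q_t. *)
Fixpoint received (M : nat) (gamma : coding_policy M) (x : nat -> X)
    (t : nat) : t.-tuple 'I_M :=
  if t is s.+1 then
    [tuple of rcons (received gamma x s)
                    (gamma s [tuple (x i : borel X) | i < s.+1]
                             (received gamma x s))]
  else [tuple].

Definition estimate (M : nat) (gamma : coding_policy M)
    (delta : estimation_policy M) (x : nat -> X) (t : nat) : X :=
  delta t (received gamma x t.+1).

Context (dO : measure_display) (Omega : measurableType dO).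
Variables (P : probability Omega R) (x : nat -> Omega -> X).

Definition objective_E1 (M : nat) (gamma : coding_policy M)
    (delta : estimation_policy M) (eps : R) : Prop :=
  exists T : nat, {ae P, forall om,
    ereal_sup [set (mdist (x t om) (estimate gamma delta (x ^~ om) t))%:E
              | t in [set t | (T <= t)%N]] <= eps%:E}.

Definition achievable (M : nat) : Prop :=
  forall eps : R, (0 < eps)%R ->
    exists (gamma : coding_policy M) (delta : estimation_policy M),
      measurable_coding gamma /\ objective_E1 gamma delta eps.

Definition C0 : \bar R :=
  ereal_inf [set (log2 (M%:R : R))%:E
            | M in [set M : nat | (0 < M)%N /\ achievable M]].

End Estimation.

(* Main.v *)
Require Import Defs.
From HB Require Import structures.
From mathcomp Require Import all_boot all_order all_algebra.
From mathcomp Require Import all_classical all_reals all_analysis.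
From mathcomp Require Import finmap measurable_realfun lebesgue_integral_fubini.
From mathcomp Require Import lra.
Set Implicit Arguments.
Unset Strict Implicit.
Unset Printing Implicit Defensive.
Import Order.TTheory GRing.Theory Num.Theory.
Import numFieldNormedType.Exports.
Local Open Scope classical_set_scope.
Local Open Scope ring_scope.
Local Open Scope ereal_scope.

(** Suppose that an alphabet of size M achieves an error e from some time T on.
    The estimates at the times T, ..., T + n depend only on the transmitted word
    of length T + n + 1, so they take at most M ^ (T + n + 1) values, and the
    state almost surely stays within e of one of these finitely many strings of
    estimates.  This property passes from the process to every point of the
    support of mu (supp_tracked): were z in the support further than e, for each
    word, from the corresponding string at some time, then an open box around
    the first n + 1 coordinates of z would consist of such points.  By shift
    invariance its mu-measure is the probability that (x_T, ..., x_(T+n)) lies in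
    it, which is zero, whereas it has to be positive.

    Both claims follow by taking e small.  Each coordinate projection of the
    support is covered by finitely many e-balls, for all e; as X is complete
    these projections are relatively compact, and the closed set supp mu is
    compact by Tychonoff's theorem (achievable_compact).  And two points of the
    support tracked by the same word are 2e-close at all times up to n, hence,
    up to the geometric tail of the path metric, indistinguishable along their
    orbits; a separated set is therefore no larger than the number of words,
    whose growth rate is log M (achievable_entropy).

    The probabilistic input is that the trajectory visits finitely many given
    Borel sets in succession with the probability prescribed by mu
    (path_law_cylinder).  Only boxes are compared, never general measurable sets
    of paths: for a nonseparable X the Borel sets of the path space need not lie
    in the product sigma-algebra, on which alone mu is prescribed. *)

(** * Law of the trajectory *)

(** Independence of Z from V makes the joint law a product measure; Tonelli's
    theorem then allows Z to be frozen while V is integrated out. *)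
Lemma independent_freezing (R : realType) d d1 d2 (Omega : measurableType d)
    (T1 : measurableType d1) (T2 : measurableType d2)
    (P : probability Omega R) (nu : probability T2 R)
    (Z : {mfun Omega >-> T1}) (V : {mfun Omega >-> T2})
    (ZV : forall A B, measurable A -> measurable B ->
       P (Z @^-1` A `&` V @^-1` B) = P (Z @^-1` A) * nu B)
    (h : (T1 * T2)%type -> \bar R) :
  measurable_fun [set: (T1 * T2)%type] h -> (forall z, 0 <= h z) ->
  \int[P]_om h (Z om, V om) = \int[P]_om \int[nu]_v h (Z om, v).
Proof.
move=> mh h0.
have mp : measurable_fun setT (fun om => (Z om, V om)) by exact/measurable_fun_pair.
pose p : {mfun Omega >-> (T1 * T2)%type} := HB.pack (fun om => (Z om, V om))
  (isMeasurableFun.Build _ _ _ _ _ mp).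
rewrite -[LHS](ge0_integral_distribution p)//.
have prodE A : measurable A -> (distribution P Z \x nu) A = distribution P p A.
  apply: product_measure_unique => B C mB mC; exact: ZV.
rewrite -(@eq_measure_integral _ _ _ _ (distribution P p) (distribution P Z \x nu)); last first.
  by move=> A mA _; exact: prodE.
rewrite fubini_tonelli1// ge0_integral_distribution//.
  exact: measurable_fun_fubini_tonelli_F.
by move=> x; exact: integral_ge0.
Qed.

Lemma measurable_preimage_mfun d1 d2 (T1 : measurableType d1)
  (T2 : measurableType d2) (g : {mfun T1 >-> T2}) B :
  measurable B -> measurable (g @^-1` B).
Proof. by move=> mB; rewrite -[X in measurable X]setTI; exact: measurable_funP. Qed.

Section MarkovPath.
Context (R : realType) (X : completeMetricType R).
Context (dW : measure_display) (W : measurableType dW) (f : X * W -> X).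
Hypothesis f_meas : measurable_fun [set: (borel X * W)%type]
                (f : (borel X * W)%type -> borel X).
Context (dO : measure_display) (Omega : measurableType dO).
Variables (P : probability Omega R).
Variables (pi0 : probability (borel X) R) (nu : probability W R).
Variables (x0 : {mfun Omega >-> borel X}) (w : nat -> {mfun Omega >-> W}).

Local Notation x := (trajectory f x0 (fun t => w t : Omega -> W)).

(** A pi-system generating the sigma-algebra of (x0, w 0, ..., w (k-1)).  As B is
    indexed by all of nat, intersections are taken coordinatewise. *)
Definition history_cylinders (k : nat) : set (set Omega) :=
  [set E | exists (A : set (borel X)) (B : nat -> set W),
     [/\ measurable A, forall j, measurable (B j) &
       E = x0 @^-1` A `&` \bigcap_(j in `I_k) (w j @^-1` B j)]].

Local Notation history k := (g_sigma_algebraType (history_cylinders k)).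

Lemma history_cylindersI k : setI_closed (history_cylinders k).
Proof.
move=> _ _ [A [B [mA mB ->]]] [A' [B' [mA' mB' ->]]].
exists (A `&` A'), (fun j => B j `&` B' j); split.
- exact: measurableI.
- by move=> j; exact: measurableI.
- rewrite preimage_setI setIACA -bigcapI; congr (_ `&` _).
Qed.

Lemma history_cylindersT k : history_cylinders k setT.
Proof.
exists setT, (fun=> setT); split=> //.
by rewrite preimage_setT setTI; apply/esym; rewrite -subTset => om _ j.
Qed.

Lemma history_cylinders_measurable k : history_cylinders k `<=` measurable.
Proof.
move=> _ [A [B [mA mB ->]]]; apply: measurableI.
  exact: measurable_preimage_mfun.
apply: bigcap_measurableType => j _; exact: measurable_preimage_mfun.
Qed.

Lemma history_measurable k (H : set Omega) :
  <<s history_cylinders k >> H -> measurable H.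
Proof.
by apply: smallest_sub; [exact: sigma_algebra_measurable|
  exact: history_cylinders_measurable].
Qed.

Lemma history_cylinders_le k : history_cylinders k `<=` history_cylinders k.+1.
Proof.
move=> _ [A [B [mA mB ->]]].
exists A, (fun j => if (j < k)%N then B j else setT); split=> //.
  by move=> j; case: ifP.
congr (_ `&` _); apply/seteqP; split=> om Hom j /= jk.
  by case: ifP => // jk'; exact: Hom.
by have := Hom j (ltnW jk); rewrite jk.
Qed.

Lemma history_x0 k : measurable_fun setT (x0 : history k -> borel X).
Proof.
move=> _ B mB; rewrite setTI; apply: sub_sigma_algebra.
exists B, (fun=> setT); split=> //.
by rewrite (_ : \bigcap_(_ in _) _ = setT) ?setIT// -subTset => om _ j.
Qed.

Lemma history_w k j : (j < k)%N -> measurable_fun setT (w j : history k -> W).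
Proof.
move=> jk _ B mB; rewrite setTI; apply: sub_sigma_algebra.
exists setT, (fun i => if i == j then B else setT); split=> //.
  by move=> i; case: ifP.
rewrite preimage_setT setTI; apply/seteqP; split=> om /=.
  by move=> Bom i _ /=; case: eqP => // ->.
by move=> /(_ j jk); rewrite eqxx.
Qed.

Lemma history_le k d (T : measurableType d) (g : Omega -> T) :
  measurable_fun setT (g : history k -> T) ->
  measurable_fun setT (g : history k.+1 -> T).
Proof.
move=> mg _ B mB; have := mg measurableT B mB.
by apply: sub_smallest2r => //; exact: history_cylinders_le.
Qed.

Lemma history_trajectory k : measurable_fun setT (x k : history k -> borel X).
Proof.
elim: k => [|k IH]; first exact: history_x0.
rewrite /=.
apply: (measurableT_comp f_meas); apply/measurable_fun_pair.
  exact: history_le.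
exact: history_w.
Qed.

Hypothesis w_law : forall t : nat, has_law P (w t) nu.
Hypothesis w_indep : mutually_independent P (fun t => w t : Omega -> W).
Hypothesis x0_w_indep :
      independent_of_sequence P x0 (fun t => w t : Omega -> W).

(** The independence of x0 from the whole noise sequence splits off the condition
    on x0, both with and without the condition on w k; the mutual independence of
    the noise then splits off the factor of w k. *)
Lemma cylinder_noise_independent k A C : history_cylinders k A -> measurable C ->
  P (A `&` w k @^-1` C) = P A * nu C.
Proof.
move=> [A' [B [mA mB ->]]] mC.
pose B' j := if j == k then C else B j.
have mB' j : measurable (B' j) by rewrite /B'; case: ifP.
pose J := fset_set `I_k.
have JE : [set` J] = `I_k by rewrite /J fset_setK.
have kJ : k \notin J.
  by rewrite /J in_fset_set// notin_setE /= ltnn.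
(* Noise cylinders belong to the sigma-algebra of the noise sequence. *)
have seqm D (m : nat -> set W) : (forall j, measurable (m j)) ->
    sequence_sigma_algebra (fun t => w t : Omega -> W) (\bigcap_(j in D) (w j @^-1` m j)).
  move=> mm.
  suff : (measurable : set (set (g_sigma_algebraType (\bigcup_t preimage_set_system setT (w t) measurable))))
     (\bigcap_(j in D) (w j @^-1` m j)) by [].
  apply: bigcap_measurableType => j _.
  apply: sub_sigma_algebra; exists j => //.
  by exists (m j) => //; rewrite setTI.
have EB : \bigcap_(j in `I_k) (w j @^-1` B j) `&` w k @^-1` C =
  \bigcap_(j in [set` (k |` J)%fset]) (w j @^-1` B' j).
  apply/seteqP; split=> om /=.
    move=> [h1 h2] j /=; rewrite !inE => /orP[/eqP ->|jJ].
      by rewrite /B' eqxx.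
    have jk : (j < k)%N by have : [set` J] j by []; rewrite JE.
    by rewrite /B' ltn_eqF//; exact: h1.
  move=> h; split.
    move=> j /= jk; have : [set` J] j by rewrite JE.
    move=> /= jJ; have := h j; rewrite /= /B' ltn_eqF//; apply.
    by rewrite !inE jJ orbT.
  by have := h k; rewrite /= /B' eqxx; apply; rewrite !inE eqxx.
have EB2 : \bigcap_(j in `I_k) (w j @^-1` B j) =
  \bigcap_(j in [set` J]) (w j @^-1` B' j).
  rewrite JE; apply/seteqP; split=> om h j jk; have := h j jk;
  by rewrite /B' /= ltn_eqF.
rewrite -setIA EB !x0_w_indep//; try exact: seqm.
rewrite w_indep// EB2 w_indep// big_fsetU1//= {1}/B' eqxx w_law//.
by rewrite [nu C * _]muleC muleA.
Qed.

(** Both sides are finite measures in A that agree on a pi-system. *)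
Lemma history_noise_independent k A C :
  <<s history_cylinders k >> A -> measurable C ->
  P (A `&` w k @^-1` C) = P A * nu C.
Proof.
move=> hA mC.
have mwC : measurable (w k @^-1` C) by exact: measurable_preimage_mfun.
have r0 : (0 <= fine (nu C))%R by rewrite fine_ge0.
have scaleE B : mscale (NngNum r0) P B = nu C * P B.
  by rewrite /mscale /= fineK// fin_num_measure.
suff : mrestr P mwC A = mscale (NngNum r0) P A.
  by move=> E; rewrite muleC -scaleE -E.
apply: (@g_sigma_algebra_measure_unique _ R Omega (history_cylinders k) _ (fun=> setT)) => //.
- exact: history_cylinders_measurable.
- by move=> _; exact: history_cylindersT.
- by rewrite bigcup_const.
- exact: history_cylindersI.
- move=> B hB; apply: etrans (esym (scaleE B)).
  by rewrite /= /mrestr cylinder_noise_independent// muleC.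
- by move=> _; rewrite /= /mrestr setTI (le_lt_trans (probability_le1 _ _))// ltry.
Qed.

Lemma measurable_section (y : borel X) :
  measurable_fun setT (fun v : W => f (y, v) : borel X).
Proof. exact: measurable_fun_pair2 f_meas. Qed.

Lemma path_weight_ge0 (Bs : seq (set (borel X))) y : 0 <= path_weight f nu Bs y.
Proof.
elim: Bs y => [|B Bs IH] y //=.
pose phi : {mfun W >-> borel X} := HB.pack (fun v : W => f (y, v) : borel X)
  (isMeasurableFun.Build _ _ _ _ _ (measurable_section y)).
by apply: (@integral_ge0 _ _ _ (distribution nu phi)).
Qed.

Let restrict_ge0 (Bs : seq (set (borel X))) B y : 0 <= (path_weight f nu Bs \_ B) y.
Proof. by rewrite patchE; case: ifP => // _; exact: path_weight_ge0. Qed.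

Let measurable_restrict d (T : measurableType d) (g : T -> \bar R) (B : set T) :
  measurable B -> measurable_fun setT g -> measurable_fun setT (g \_ B).
Proof.
by move=> mB mg; apply/(measurable_restrictT g mB); exact: measurable_funTS.
Qed.

(** The transition kernel is the law of f (y, v) for v of law nu, so that the
    outer integral becomes an integral over the noise. *)
Lemma path_weight_cons (Bs : seq (set (borel X))) B y :
  measurable B -> measurable_fun [set: borel X] (path_weight f nu Bs) ->
  path_weight f nu (B :: Bs) y = \int[nu]_v (path_weight f nu Bs \_ B) (f (y, v)).
Proof.
move=> mB mpw /=; rewrite integral_mkcond /transition_kernel; first exact: measurable_section.
move=> mphi; rewrite (ge0_integral_pushforward mphi)//.
exact: measurable_restrict.
Qed.

Lemma measurable_path_weight (Bs : seq (set (borel X))) :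
  (forall i, measurable (nth set0 Bs i)) ->
  measurable_fun [set: borel X] (path_weight f nu Bs).
Proof.
elim: Bs => [|B Bs IH] mBs; first exact: measurable_cst.
have mB : measurable B by exact: (mBs 0%N).
have {}IH := IH (fun i => mBs i.+1).
rewrite (_ : path_weight f nu (B :: Bs) =
   fun y => \int[nu]_v (path_weight f nu Bs \_ B) (f (y, v))); last first.
  by apply/funext => y; exact: path_weight_cons.
apply: (@measurable_fun_fubini_tonelli_F _ _ (borel X) W R nu
  (fun z : (borel X * W)%type => (path_weight f nu Bs \_ B) (f z))) => //.
apply: measurableT_comp f_meas.
exact: measurable_restrict.
Qed.

(** The event that the states at times k + 1, k + 2, ... lie in the successive
    members of Bs. *)
Fixpoint follows (Bs : seq (set (borel X))) (k : nat) : set Omega :=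
  if Bs is B :: Bs' then (x k.+1 @^-1` B) `&` follows Bs' k.+1 else setT.

(** Markov property: given a past event H up to time k, the future visits occur
    with conditional probability path_weight at the current state.  In the
    induction the first visit is absorbed into the past, and the noise w k that
    produced it is then integrated out against the frozen history. *)
Lemma markov_path (Bs : seq (set (borel X))) k H :
  (forall i, measurable (nth set0 Bs i)) ->
  <<s history_cylinders k >> H ->
  P (H `&` follows Bs k) = \int[P]_(om in H) path_weight f nu Bs (x k om).
Proof.
elim: Bs k H => [|B Bs IH] k H mBs hH /=.
  by rewrite setIT integral_cst ?mul1e//; exact: history_measurable hH.
have mB : measurable B by exact: (mBs 0%N).
have {}mBs i : measurable (nth set0 Bs i) := mBs i.+1.
have mpw := measurable_path_weight mBs.
have mxB : measurable (x k.+1 @^-1` B : set (history k.+1)).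
  rewrite -[X in measurable X]setTI.
  by apply: (@history_trajectory k.+1).
have hH' : <<s history_cylinders k.+1 >> (H `&` x k.+1 @^-1` B).
  suff : measurable (H `&` x k.+1 @^-1` B : set (history k.+1)) by [].
  apply: measurableI => //.
  by apply: sub_smallest2r hH => //; exact: history_cylinders_le.
rewrite setIA IH//.
pose g (y : borel X) := (path_weight f nu Bs \_ B) y.
have mg : measurable_fun [set: borel X] g.
  exact: measurable_restrict.
(* The frozen variable is the outcome itself, observed through the history
   sigma-algebra only. *)
have mid : measurable_fun [set: Omega] (idfun : Omega -> history k).
  by move=> _ E /history_measurable mE; rewrite setTI.
pose Z : {mfun Omega >-> history k} := HB.pack (idfun : Omega -> history k)
  (isMeasurableFun.Build _ _ _ _ _ mid).
pose h (z : (history k * W)%type) : \bar R :=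
  ((fun z => g (f (x k z.1, z.2))) \_ (H `*` setT)) z.
have h0 z : 0 <= h z.
  by rewrite /h patchE; case: ifP => // _; exact: restrict_ge0.
have mh : measurable_fun [set: (history k * W)%type] h.
  apply: measurable_restrict; first exact: measurableX.
  apply: (measurableT_comp mg); apply: (measurableT_comp f_meas).
  apply/measurable_fun_pair => //.
  apply: (@measurableT_comp _ _ _ _ _ _ (x k : history k -> borel X)) => //.
  exact: history_trajectory.
transitivity (\int[P]_om h (Z om, w k om)).
  rewrite integral_mkcond; apply: eq_integral => om _.
  rewrite /h patchE in_setI patchE in_setX in_setT andbT /=.
  by case: (om \in H) => //=; rewrite /g patchE [_ \in B]asboolE.
rewrite (@independent_freezing _ _ _ _ _ _ _ P nu Z (w k))//; last first.
  by move=> E C hE mC; rewrite history_noise_independent.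
rewrite [RHS]integral_mkcond; apply: eq_integral => om _.
rewrite patchE; under eq_integral do rewrite /h patchE in_setX in_setT andbT /=.
case: (om \in H) => //=; last by rewrite integral0.
by rewrite -path_weight_cons.
Qed.

Lemma measurable_visits (n : nat) (B : nat -> set (borel X)) :
  (forall i, measurable (B i)) ->
  measurable [set om | forall i, (i <= n)%N -> B i (x i om)].
Proof.
move=> mB; rewrite [X in measurable X](_ : _ =
  \bigcap_(i in [set i | (i <= n)%N]) (x i @^-1` B i)) //.
apply: bigcap_measurableType => i _; apply: (@history_measurable i).
suff : measurable (x i @^-1` B i : set (history i)) by [].
by rewrite -[X in measurable X]setTI; exact: history_trajectory.
Qed.

Hypothesis x0_law : has_law P x0 pi0.

Lemma path_law_cylinder (mu : probability (borel (path_space X)) R) n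
    (B : nat -> set (borel X)) :
  path_law f nu pi0 mu -> (forall i, measurable (B i)) ->
  P [set om | forall i, (i <= n)%N -> B i (x i om)] =
  mu [set z | forall i, (i <= n)%N -> B i (z i)].
Proof.
move=> [_ /(_ n B) muE] mB; rewrite muE//.
have mBs i : measurable (nth set0 [seq B j | j <- iota 1 n] i).
  have [ni|ni] := leqP (size (iota 1 n)) i.
    by rewrite nth_default// size_map.
  by rewrite (nth_map 0%N).
have followsE m k om : follows [seq B j | j <- iota k.+1 m] k om <->
    forall i, (k < i <= k + m)%N -> B i (x i om).
  elim: m k => [|m IH] k /=.
    by split=> // _ i; rewrite addn0; case: ltngtP.
  rewrite /setI /= IH; split.
    move=> [Bk Bs] i /andP[]; rewrite leq_eqVlt => /predU1P[<- //|ki im].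
    by apply: Bs; rewrite ki addSnnS.
  move=> Bs; split; first by apply: Bs; rewrite leqnn addnS ltnS leq_addr.
  by move=> i /andP[ki im]; apply: Bs; rewrite (ltnW ki) -addSnnS.
transitivity (P (x0 @^-1` (B 0%N) `&` follows [seq B j | j <- iota 1 n] 0)).
  congr (P _); apply/seteqP; split=> om /=.
    move=> h; split; first exact: (h 0%N).
    by apply/followsE => i /andP[_ ?]; exact: h.
  by move=> [h0 /followsE h] [//|i] ni; apply: h.
rewrite markov_path//; last first.
  suff : measurable (x0 @^-1` (B 0%N) : set (history 0)) by [].
  by rewrite -[X in measurable X]setTI; apply: history_x0.
rewrite (_ : \int[pi0]_(y in B 0%N) _ =
  \int[distribution P x0]_(y in B 0%N) path_weight f nu [seq B j | j <- iota 1 n] y).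
  rewrite ge0_integral_pushforward//.
  - apply: measurable_funTS; exact: measurable_path_weight.
  - by move=> y _; exact: path_weight_ge0.
by apply: eq_measure_integral => A mA _; exact/esym/x0_law.
Qed.

End MarkovPath.

(** * Compact sets of paths *)

Section TotallyBounded.
Context (R : realType) (X : completeMetricType R).

Lemma ultra_finite_cover (I : eqType) (T : Type) (F : set_system T) (FU : UltraFilter F)
    (s : seq I) (A : I -> set T) :
  F [set y | exists2 c, c \in s & A c y] -> exists2 c, c \in s & F (A c).
Proof.
elim: s => [FA|c s IH FA]; first by have /filter_ex[y /= [c]] := FA.
have [Fc|Fc] := in_ultra_setVsetC (A c) FU.
  by exists c => //; exact: mem_head.
have [|c' sc' Fc'] := IH.
  apply: filterS2 FA Fc => y [c']; rewrite inE => /predU1P[->|sc'] Ac' nAc //.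
  by exists c'.
by exists c' => //; rewrite inE sc' orbT.
Qed.

(** An ultrafilter on A contains one ball of each finite cover, so it is Cauchy,
    and it converges by completeness. *)
Lemma totally_bounded_compact (A : set X) : closed A ->
  (forall e : R, (0 < e)%R ->
     exists s : seq X, forall y, A y -> exists2 c, c \in s & (mdist c y <= e)%R) ->
  compact A.
Proof.
move=> clA tbA; rewrite compact_ultra => F FU FA.
have Fcvg : cvg F.
  apply: cauchy_cvg; apply: cauchy_exP => e e0.
  have [s sA] := tbA (e / 2)%R (divr_gt0 e0 (ltr0n _ 2)).
  have [|c _ Fc] := @ultra_finite_cover _ _ F FU s (fun c => [set y | mdist c y <= e / 2]%R).
    by apply: filterS FA => y /sA.
  exists c; apply: filterS Fc => y /= cy; rewrite ballEmdist /=.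
  by rewrite (le_lt_trans cy)// ltr_pdivrMr// ltr_pMr// ltr1n.
exists (lim F); split=> //.
apply: clA => B /Fcvg FB; have FAB : F (A `&` B) by exact: filterI.
exact: filter_ex FAB.
Qed.

Lemma open_far (c : X) (e : R) : open [set y | (e < mdist y c)%R].
Proof.
rewrite openE => y /= ey; apply/nbhs_ballP.
exists (mdist y c - e)%R => /=; first by rewrite subr_gt0.
move=> z; rewrite ballEmdist/= ltrBrDl -ltrBrDr => yz.
by rewrite (lt_le_trans yz)// lerBlDl metric_triangle.
Qed.

Lemma path_compact (K : set (path_space X)) : closed K ->
  (forall (t : nat) (e : R), (0 < e)%R ->
     exists s : seq X, forall z, K z -> exists2 c, c \in s & (mdist c (z t) <= e)%R) ->
  compact K.
Proof.
move=> clK tbK.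
pose A (t : nat) := closure [set z t | z in K].
have cA t : compact (A t).
  apply: totally_bounded_compact; first exact: closed_closure.
  move=> e e0; have [s sK] := tbK t (e / 2)%R (divr_gt0 e0 (ltr0n _ 2)).
  exists s => y /(_ (ball y (e / 2))%R)[].
    by apply: nbhsx_ballx; rewrite divr_gt0.
  move=> _ [[z Kz <-]]; rewrite ballEmdist /= => yz.
  have [c sc cz] := sK z Kz; exists c => //.
  by rewrite (le_trans (metric_triangle _ (z t) _))// [e]splitr lerD// metric_sym ltW.
apply: (subclosed_compact clK (tychonoff cA)).
by move=> z Kz t; apply: subset_closure; exists z.
Qed.

End TotallyBounded.

(** * Counting separated paths by words *)

Section PathDistance.
Context (R : realType) (X : completeMetricType R).
Implicit Types (x y z : path_space X) (K : set (path_space X)).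

(** The weights 2^-t sum to 2 and their tail from m on to 2 * 2^-m; the distance
    contributes at most e per unit of weight before m and at most 1 after. *)
Lemma path_dist_le x y (m : nat) (e : R) : (0 <= e)%R ->
  (forall t, (t < m)%N -> (mdist (x t) (y t) <= e)%R) ->
  (path_dist x y <= 2 * e + 2 * 2 ^- m)%R.
Proof.
move=> e0 xy.
pose u (t : nat) : R := (2 ^- t * (mdist (x t) (y t) / (1 + mdist (x t) (y t))))%R.
pose S (n : nat) : R := (\sum_(0 <= t < n) u t)%R.
have d0 t : (0 <= mdist (x t) (y t))%R by exact: mdist_ge0.
have p0 (n : nat) : (0 < 2 ^- n :> R)%R by rewrite invr_gt0 exprn_gt0.
have u0 t : (0 <= u t)%R.
  by rewrite mulr_ge0 ?divr_ge0 ?addr_ge0 ?(ltW (p0 _)).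
have ud t : (u t <= 2 ^- t * mdist (x t) (y t))%R.
  rewrite ler_wpM2l ?(ltW (p0 _))// ler_pdivrMr ?ltr_wpDr//.
  by rewrite mulrDr mulr1 lerDl mulr_ge0.
have u1 t : (u t <= 2 ^- t)%R.
  rewrite -[leRHS]mulr1 ler_wpM2l ?(ltW (p0 _))// ler_pdivrMr ?ltr_wpDr// mul1r.
  by rewrite lerDr.
have pS (n : nat) : (2 ^- n.+1 = 2 ^- n / 2 :> R)%R.
  by rewrite exprS invfM mulrC.
(* The partial sums of 2^-t are 2 - 2 * 2^-n, which makes both inductive bounds
   telescope. *)
have S_head n : (n <= m)%N -> (S n <= e * (2 - 2 * 2 ^- n))%R.
  elim: n => [_|n IH nm].
    by rewrite /S big_geq// expr0 invr1 mulr1 subrr mulr0.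
  rewrite /S big_nat_recr//= -/(S n).
  have := IH (ltnW nm); have := ud n; have := xy n nm; have := p0 n.
  rewrite pS; move: (u n) (S n) (mdist _ _) (2 ^- n)%R => a b c p; nra.
have S_tail k : (S (m + k)%N <= 2 * e + 2 * 2 ^- m - 2 * 2 ^- (m + k))%R.
  elim: k => [|k IH].
    rewrite addn0; have := S_head m (leqnn m); have := p0 m.
    move: (S m) (2 ^- m)%R => b p; nra.
  rewrite addnS /S big_nat_recr//= -/(S _); have := u1 (m + k)%N.
  rewrite pS; lra.
have S_le n : (S n <= 2 * e + 2 * 2 ^- m)%R.
  have [nm|/ltnW mn] := leqP n m.
    by have := S_head n nm; have := p0 n; have := p0 m; nra.
  by have := S_tail (n - m)%N; rewrite subnKC//; have := p0 n; lra.
apply: limr_le; last by apply: nearW => n; exact: S_le.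
apply: nondecreasing_is_cvgn.
  apply/nondecreasing_seqP => n; rewrite big_nat_recr//= lerDl; exact: u0.
by exists (2 * e + 2 * 2 ^- m)%R => _ [n _ <-]; exact: S_le.
Qed.

Lemma iter_left_shift x i t : iter i (@left_shift X) x t = x (t + i)%N.
Proof.
elim: i t => [|i IH] t; first by rewrite addn0.
by rewrite iterS /left_shift IH addSnnS.
Qed.

(** The set of strings c q, for q in Q, is an e-net of K for the supremum distance
    over the times 0, ..., n. *)
Definition tracked_by (Q : Type) (c : Q -> nat -> X) (e : R) (n : nat) K :=
  forall z, K z ->
    exists q, forall i, (i <= n)%N -> (mdist (z i) (c q i) <= e)%R.

(** Distinct separated points have distinct tracking words: two points with the
    same word are 2e-close at all times up to n + m, hence within
    2 * (2e) + 2 * 2^-m of each other under each of the first n shifts. *)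
Lemma separated_size (Q : finType) (c : Q -> nat -> X) K (n m : nat) (e eps : R) s :
  (0 <= e)%R -> (4 * e + 2 * 2 ^- m <= eps)%R ->
  tracked_by c e (n + m) K ->
  separated_seq (@path_dist R X) (@left_shift X) K n eps s ->
  (size s <= #|Q|)%N.
Proof.
move=> e0 eps_ge track [us sK sep].
(* Points outside K get the code None, so Q may be empty. *)
have /choice[code codeP] (z : path_space X) : exists oq, K z ->
    if oq is Some q then forall i, (i <= n + m)%N -> (mdist (z i) (c q i) <= e)%R
    else False.
  have [/track[q zq]|nKz] := pselect (K z); first by exists (Some q).
  by exists None.
have code_inj : {in s &, injective code}.
  move=> x y xs ys xy; apply/eqP; apply/negPn/negP => /(sep x y xs ys).
  rewrite ltNge => /negP; apply.
  have eps0 : (0 <= eps)%R.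
    by rewrite (le_trans _ eps_ge)// addr_ge0 ?mulr_ge0.
  apply: bigmax_le => // i _.
  rewrite (le_trans _ eps_ge)// (_ : 4 * e = 2 * (2 * e))%R; last by lra.
  apply: path_dist_le => [|t tm]; first by rewrite mulr_ge0.
  rewrite !iter_left_shift.
  have := codeP x (sK x xs); have := codeP y (sK y ys); rewrite xy.
  case: (code y) => // q yq xq.
  have tim : (t + i <= n + m)%N by rewrite addnC leq_add// ltnW// ltn_ord.
  have := metric_triangle (x (t + i)%N) (c q (t + i)%N) (y (t + i)%N).
  have := metric_sym (c q (t + i)%N) (y (t + i)%N).
  by have := xq _ tim; have := yq _ tim; lra.
have cs : {in s, forall z, exists q, code z = Some q}.
  by move=> z zs; have := codeP z (sK z zs); case: (code z) => // q _; exists q.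
rewrite -(size_map code) cardE.
have -> : size (map code s) = size (pmap id (map code s)).
  rewrite size_pmap count_map size_map; apply/esym/eqP; rewrite -all_count.
  by apply/allP => z /cs[q] /= ->.
apply: uniq_leq_size => [|q _]; last by rewrite mem_enum.
apply: (@map_uniq _ _ Some); rewrite pmapS_filter map_id.
by apply: filter_uniq; rewrite map_inj_in_uniq.
Qed.

End PathDistance.

(** * Entropy bounds from the growth of separated sets *)

Section EntropyBound.
Context (R : realType).

Lemma limn_esup_le (u v : nat -> \bar R) (l : \bar R) :
  (forall n, (0 < n)%N -> u n <= v n) -> v @ \oo --> l -> limn_esup u <= l.
Proof.
move=> uv vl; rewrite limn_esup_lim -(cvg_lim _ (cvg_esups vl))//.
apply: lee_lim; [exact: is_cvg_esups|exact: is_cvg_esups|].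
near=> n; apply: ge_ereal_sup => _ [k /= nk <-].
apply: (le_trans (uv k _)); last by apply: ereal_sup_ubound; exists k.
by rewrite (leq_trans _ nk)//; near: n; exists 1%N.
Unshelve. all: by end_near. Qed.

Lemma le_limn_esup (u v : nat -> \bar R) :
  (forall n, u n <= v n) -> limn_esup u <= limn_esup v.
Proof.
move=> uv; rewrite !limn_esup_lim.
apply: lee_lim; [exact: is_cvg_esups|exact: is_cvg_esups|].
near=> n; apply: ge_ereal_sup => _ [k /= nk <-].
by apply: (le_trans (uv k)); apply: ereal_sup_ubound; exists k.
Unshelve. all: by end_near. Qed.

Lemma ln2_gt0 : (0 < ln 2 :> R)%R.
Proof. by rewrite ln_gt0// ltr1n. Qed.

Lemma log2e_nat (k : nat) : (0 < k)%N ->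
  log2e (k%:R%:E : \bar R) = (log2 k%:R)%:E.
Proof. by move=> k0; rewrite /log2e lne_EFin ?ltr0n// -EFinM. Qed.

Lemma le_log2e (a b : \bar R) : 0 <= a -> a <= b -> log2e a <= log2e b.
Proof.
move=> a0 ab; apply: lee_wpmul2r.
  by rewrite lee_fin invr_ge0 ltW// ln2_gt0.
by rewrite lee_lne// in_itv/= leey andbT// (le_trans a0).
Qed.

Context (Y : choiceType).
Implicit Types (rho : Y -> Y -> R) (T : Y -> Y) (K : set Y).

Lemma max_separated_ge0 rho T K n eps : 0 <= max_separated rho T K n eps.
Proof.
apply: ereal_sup_ubound; exists [::] => //; split=> //.
Qed.

(** The constant b only adds b * log M / n to the growth rate, which vanishes in
    the limit. *)
Lemma entropy_at_scale_growth rho T K (eps : R) (M b : nat) : (0 < M)%N ->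
  (forall n s, separated_seq rho T K n eps s -> (size s <= M ^ (b + n))%N) ->
  entropy_at_scale rho T K eps <= (log2 (M%:R : R))%:E.
Proof.
move=> M0 sM; set L := log2 M%:R.
have L0 : (0 <= L)%R.
  by rewrite divr_ge0 ?(ltW ln2_gt0)// ln_ge0// ler1n.
(* The factor 2 makes up for n.+1 instead of n in the harmonic sequence. *)
pose v n : \bar R := (L + 2 * b%:R * L * n.+1%:R^-1)%:E.
apply: (@limn_esup_le _ v); last first.
  apply: cvg_EFin; first exact: nearW.
  rewrite -[in X in _ --> X](addr0 L); apply: cvgD; first exact: cvg_cst.
  rewrite -(mulr0 (2 * b%:R * L)%R).
  by apply: cvgMl_tmp; exact: cvg_harmonic.
move=> n n0.
have maxM : max_separated rho T K n eps <= (M ^ (b + n))%:R%:E.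
  by apply: ge_ereal_sup => _ [s /sM sn <-]; rewrite lee_fin ler_nat.
have := le_log2e (max_separated_ge0 _ _ _ _ _) maxM.
rewrite log2e_nat ?expn_gt0 ?M0// => maxL.
have logE : (log2 (M ^ (b + n))%:R = (b + n)%:R * L :> R)%R.
  by rewrite /L /log2 natrX lnXn ?ltr0n// -[(ln _ *+ _)%R]mulr_natl mulrA.
have n1 : (0 <= n%:R^-1 :> R)%R by rewrite invr_ge0.
apply: (le_trans (lee_wpmul2l _ maxL)); first by rewrite lee_fin.
rewrite logE -EFinM lee_fin natrD mulrA mulrDr mulVf ?pnatr_eq0 ?gtn_eqF//.
have n2 : (n%:R^-1 <= 2 * n.+1%:R^-1 :> R)%R.
  rewrite ler_pdivlMr ?ltr0n// ler_pdivrMl ?ltr0n// mulrC -natrM ler_nat.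
  by rewrite mulSn mul1n -addn1 leq_add2l.
have bL : (0 <= b%:R * L)%R by rewrite mulr_ge0.
have := ler_wpM2r bL n2.
move: (n%:R^-1)%R (n.+1%:R^-1)%R (b%:R)%R => p q r; lra.
Qed.

(** Separation at a larger scale is more demanding.  This monotonicity is what makes
    the limit defining the entropy exist. *)
Lemma entropy_at_scale_anti rho T K : {homo entropy_at_scale rho T K : a b / (a <= b)%R >-> b <= a}.
Proof.
move=> a b ab; apply: le_limn_esup => n; apply: lee_wpmul2l.
  by rewrite lee_fin invr_ge0.
apply: le_log2e; first exact: max_separated_ge0.
apply: ereal_sup_le => _ [s [us sK sep] <-]; exists s => //; split=> //.
by move=> x y xs ys /(sep x y xs ys); exact: le_lt_trans.
Qed.

Lemma topological_entropy_le rho T K (l : \bar R) :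
  (forall eps : R, (0 < eps)%R -> entropy_at_scale rho T K eps <= l) ->
  topological_entropy rho T K <= l.
Proof.
move=> Kl; apply: lime_le.
  apply: nonincreasing_at_right_is_cvge; apply: nearW => b x y _ _.
  exact: entropy_at_scale_anti.
near=> e; apply: Kl; near: e; exact: nbhs_right_gt.
Unshelve. all: by end_near. Qed.

End EntropyBound.

(** * Strings of estimates attached to words *)

Section Words.
Context (R : realType) (X : completeMetricType R) (M : nat).
Variables (gamma : coding_policy X M.+1) (delta : estimation_policy X M.+1).

Definition word_prefix (N t : nat) (q : N.-tuple 'I_M.+1) : t.-tuple 'I_M.+1 :=
  [tuple nth ord0 q i | i < t].

Lemma nth_received (x : nat -> X) (N t i : nat) : (i < t)%N -> (t <= N)%N ->
  nth ord0 (received gamma x N) i = nth ord0 (received gamma x t) i.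
Proof.
move=> it; elim: N => [|N IH]; first by rewrite leqn0 => /eqP ->.
rewrite leq_eqVlt ltnS => /predU1P[-> //|tN].
by rewrite /= nth_rcons size_tuple (leq_trans it tN) IH.
Qed.

Lemma word_prefix_received (x : nat -> X) (N t : nat) : (t <= N)%N ->
  word_prefix t (received gamma x N) = received gamma x t.
Proof.
move=> tN; apply: eq_from_tnth => i.
by rewrite tnth_mktuple (tnth_nth ord0) (@nth_received x N t).
Qed.

Definition codebook (T n : nat) (q : (T + n).+1.-tuple 'I_M.+1) (i : nat) : X :=
  delta (word_prefix (T + i).+1 q).

Lemma codebook_received (x : nat -> X) (T n i : nat) : (i <= n)%N ->
  codebook (received gamma x (T + n).+1) i = estimate gamma delta x (T + i).
Proof. by move=> i_n; rewrite /codebook word_prefix_received// ltnS leq_add2l. Qed.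

End Words.

Lemma open_forall (I : finType) (T : topologicalType) (A : I -> set T) :
  (forall i, open (A i)) -> open [set x | forall i, A i x].
Proof.
move=> oA; rewrite openE => x Ax; apply: filter_forall => i.
by apply: open_nbhs_nbhs; split; [exact: oA|exact: Ax].
Qed.

(** * Tracking the support *)

Section Support.
Context (R : realType) (X : completeMetricType R).
Variable mu : probability (borel (path_space X)) R.

Lemma open_cylinder (n : nat) (U : nat -> set X) : (forall i, open (U i)) ->
  open [set z : path_space X | forall i, (i <= n)%N -> U i (z i)].
Proof.
move=> oU; rewrite (_ : mkset _ =
    [set z : path_space X | forall i : 'I_n.+1, U i (z i)]); last first.
  apply/seteqP; split=> z /= Uz i; first by apply: Uz; rewrite -ltnS.
  by move=> i_n; exact: (Uz (Ordinal (i_n : (i < n.+1)%N))).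
apply: open_forall => i.
apply: (@open_comp (path_space X) X (fun z => z i)) => // z _.
exact: (@proj_continuous nat (fun=> X) i z).
Qed.

Lemma closed_supp : closed (supp mu).
Proof.
move=> z clz U oU Uz; have [|z' [suppz' Uz']] := clz U.
  by apply: open_nbhs_nbhs.
exact: suppz'.
Qed.

Hypothesis mu_shift : forall A : set (borel (path_space X)), measurable A ->
  mu (@left_shift X @^-1` A) = mu A.

(** The boxes U imposed from time T on, with no condition before. *)
Definition delay (T : nat) (U : nat -> set X) (j : nat) : set X :=
  if (T <= j)%N then U (j - T)%N else setT.

Lemma open_delay T U : (forall i, open (U i)) -> forall j, open (delay T U j).
Proof. by move=> oU j; rewrite /delay; case: ifP => // _; exact: openT. Qed.

Lemma delay_cylinder (T n : nat) (U : nat -> set X) :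
  [set z : path_space X | forall i, (i <= n)%N -> U i (z (T + i)%N)] =
  [set z : path_space X | forall j, (j <= T + n)%N -> delay T U j (z j)].
Proof.
apply/seteqP; split=> z /= Uz i.
  move=> iTn; rewrite /delay; case: ifP => // Ti.
  by have := Uz (i - T)%N; rewrite subnKC//; apply; rewrite leq_subLR.
by move=> i_n; have := Uz (T + i)%N; rewrite /delay leq_addr addKn leq_add2l; exact.
Qed.

Lemma cylinder_shift (T n : nat) (U : nat -> set X) : (forall i, open (U i)) ->
  mu [set z : path_space X | forall i, (i <= n)%N -> U i (z (T + i)%N)] =
  mu [set z : path_space X | forall i, (i <= n)%N -> U i (z i)].
Proof.
move=> oU; elim: T => [//|T <-].
rewrite -[RHS]mu_shift; last first.
  apply: sub_sigma_algebra; rewrite delay_cylinder.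
  by apply: open_cylinder; exact: open_delay.
by congr (mu _); apply/seteqP; split=> z /= Uz i /Uz; rewrite /left_shift addSn.
Qed.

Context (dO : measure_display) (Omega : measurableType dO).
Variables (P : probability Omega R) (x : nat -> Omega -> X).
Hypothesis visits_measurable : forall (n : nat) (B : nat -> set (borel X)),
  (forall i, measurable (B i)) ->
  measurable [set om | forall i, (i <= n)%N -> B i (x i om)].
Hypothesis visits_law : forall (n : nat) (B : nat -> set (borel X)),
  (forall i, measurable (B i)) ->
  P [set om | forall i, (i <= n)%N -> B i (x i om)] =
  mu [set z | forall i, (i <= n)%N -> B i (z i)].

(** Otherwise, each word q has a time i at which z is further than e from the
    estimate c q i.  The paths that are also further than e wherever z is form an
    open box around z.  It has positive measure, yet after a delay of T the
    process almost surely avoids it, because of the word actually transmitted. *)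
Lemma supp_tracked (M : nat) (gamma : coding_policy X M.+1)
    (delta : estimation_policy X M.+1) (e : R) :
  objective_E1 P x gamma delta e ->
  exists T, forall n, tracked_by (codebook delta (T := T) (n := n)) e n (supp mu).
Proof.
move=> [T aeE]; exists T => n z suppz.
apply: contrapT => /forallNP noword.
pose c := codebook delta (T := T) (n := n).
pose U i : set X := [set y | forall q, (e < mdist (z i) (c q i))%R ->
                                       (e < mdist y (c q i))%R].
have oU i : open (U i).
  apply: (@open_forall _ _ (fun q => [set y | (e < mdist (z i) (c q i))%R ->
                                       (e < mdist y (c q i))%R])) => q.
  have [ez|ez] := boolP (e < mdist (z i) (c q i))%R.
    rewrite (_ : mkset _ = [set y | (e < mdist y (c q i))%R]).
      exact: open_far.
    by apply/seteqP; split=> y //= /(_ isT).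
  rewrite (_ : mkset _ = setT); first exact: openT.
  by apply/seteqP; split=> y //= _; rewrite (negbTE ez).
pose B j : set (borel X) := delay T U j.
have mB j : measurable (B j).
  by apply: sub_sigma_algebra; exact: open_delay.
have : 0 < mu [set z : path_space X | forall i, (i <= n)%N -> U i (z i)].
  by apply: suppz; [exact: open_cylinder|move=> i _ q].
rewrite -(cylinder_shift T n oU) delay_cylinder -(visits_law _ mB) measure_negligible ?ltxx//.
  exact: visits_measurable.
apply: negligibleS aeE => om /= Bom.
move=> le_sup; apply: noword (received gamma (x ^~ om) (T + n).+1) _ => i i_n.
rewrite leNgt; apply/negP => far.
have := Bom (T + i)%N; rewrite leq_add2l => /(_ i_n).
rewrite /B /delay leq_addr addKn => /(_ _ far); apply/negP; rewrite -leNgt.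
rewrite /c codebook_received// -lee_fin; apply: (le_trans _ le_sup).
by apply: ereal_sup_ubound; exists (T + i)%N => //=; rewrite leq_addr.
Qed.

(** The projection of the support to time t is covered by the balls around the
    possible estimates at time T + t. *)
Lemma achievable_compact (M : nat) : (0 < M)%N -> achievable P x M ->
  compact (supp mu).
Proof.
case: M => // M _ ach; apply: path_compact; first exact: closed_supp.
move=> t e e0; have [gamma [delta [_ /supp_tracked[T track]]]] := ach e e0.
exists [seq codebook delta (T := T) (n := t) q t | q <- enum {: _.-tuple 'I_M.+1}].
move=> z /(track t)[q zq]; exists (codebook delta q t).
  by apply: map_f; rewrite mem_enum.
by rewrite metric_sym; exact: zq.
Qed.

Lemma achievable_entropy (M : nat) : (0 < M)%N -> achievable P x M ->
  topological_entropy (@path_dist R X) (@left_shift X) (supp mu)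
  <= (log2 (M%:R : R))%:E.
Proof.
case: M => // M _ ach; apply: topological_entropy_le => eps eps0.
have e0 : (0 < eps / 8)%R by rewrite divr_gt0.
have [gamma [delta [_ /supp_tracked[T track]]]] := ach _ e0.
(* With e = eps / 8 and 2^-m < eps / 4 one has 4 e + 2 * 2^-m <= eps. *)
have [m /= mP] : exists m : nat, (1 / 2 ^+ m < eps / 4)%R.
  have eps4 : (0 < eps / 4)%R by rewrite divr_gt0.
  have [N _ NP] := near_infty_natSinv_expn_lt (PosNum eps4).
  by exists N; apply: NP => /=.
apply: (@entropy_at_scale_growth _ _ _ _ _ _ M.+1 (T + m).+1) => // n s seps.
apply: (leq_trans (separated_size (ltW e0) _ (track (n + m)%N) seps)).
  by move: mP; rewrite div1r; lra.
by rewrite card_tuple card_ord addSn addnAC addnA.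
Qed.

End Support.

Theorem mainTheorem1 (R : realType) (X : completeMetricType R)
    (dW : measure_display) (W : measurableType dW)
    (f : X * W -> X)
    (f_meas : measurable_fun [set: (borel X * W)%type]
                (f : (borel X * W)%type -> borel X))
    (f_homeo : forall w : W, homeomorphism (fun x : X => f (x, w)))
    (dO : measure_display) (Omega : measurableType dO)
    (P : probability Omega R)
    (pi0 : probability (borel X) R) (nu : probability W R)
    (x0 : {mfun Omega >-> borel X}) (w : nat -> {mfun Omega >-> W})
    (x0_law : has_law P x0 pi0)
    (w_law : forall t : nat, has_law P (w t) nu)
    (w_indep : mutually_independent P (fun t => w t : Omega -> W))
    (x0_w_indep :
      independent_of_sequence P x0 (fun t => w t : Omega -> W))
    (pi0_stationary : stationary f nu pi0)
    (mu : probability (borel (path_space X)) R)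
    (mu_law : path_law f nu pi0 mu) :
  let x := trajectory f x0 (fun t => w t : Omega -> W) in
  (~ compact (supp mu) -> C0 P x = +oo) /\
  (compact (supp mu) ->
     topological_entropy (@path_dist R X) (@left_shift X) (supp mu) <= C0 P x).
Proof.
move=> x.
have [mu_shift _] := mu_law.
have visits_measurable := measurable_visits f_meas x0 w.
have visits_law n (B : nat -> set (borel X)) (mB : forall i, measurable (B i)) :
    P [set om | forall i, (i <= n)%N -> B i (x i om)] =
    mu [set z | forall i, (i <= n)%N -> B i (z i)] :=
  path_law_cylinder f_meas w_law w_indep x0_w_indep x0_law n mu_law mB.
split=> [ncompact|_].
  rewrite /C0 (_ : [set _ | _ in _] = set0) ?ereal_inf0// -subset0.
  move=> y [M [M0 ach] _]; apply: ncompact.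
  exact: (achievable_compact mu_shift visits_measurable visits_law M0 ach).
apply: le_ereal_inf_tmp => _ [M [M0 ach] <-].
exact: (achievable_entropy mu_shift visits_measurable visits_law M0 ach).
Qed.
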